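(* Let $\diamond$ be one of the unary operations maximal ($\mathcal{F}\mapsto\mathcal{F}^\uparrow$) or minimal ($\mathcal{F}\mapsto\mathcal{F}^\downarrow$). Then there exist, for each positive integer $m$, a finite ground set $U_m$ with $|U_m|=O(m^2)$, a total order $<_m$ on $U_m$, and a family $\mathcal{F}_m$ of subsets of $U_m$ such that $Z_{<_m}(\mathcal{F}_m)=O(m^4)$ and $Z_{<_m}(\mathcal{F}_m^\diamond)=\Omega(2^{m}/\mathrm{poly}(m))$, i.e. $Z_{<_m}(\mathcal{F}_m^\diamond)\ge 2^m/p(m)$ for some polynomial $p$ and all sufficiently large $m$.
   Context: A family of sets is a set of subsets of a finite ground set $U$. Maximal: $\mathcal{F}^\uparrow=\{F\in\mathcal{F}\mid\forall F'\in\mathcal{F}: F\subseteq F'\Rightarrow F=F'\}$. Minimal: $\mathcal{F}^\downarrow=\{F\in\mathcal{F}\mid\forall F'\in\mathcal{F}: F'\subseteq F\Rightarrow F=F'\}$. A zero-suppressed binary decision diagram (ZDD) with respect to a total order $<$ on $U$ is a rooted DAG with two terminal nodes $\top,\bot$ and internal nodes $\mathtt{n}$, each with a label $\mathsf{lb}(\mathtt{n})\in U$ and children $\mathsf{lo}(\mathtt{n}),\mathsf{hi}(\mathtt{n})$, labels strictly increasing along arcs. A node represents: $\{\emptyset\}$ if $\top$, $\emptyset$ if $\bot$, and $\mathcal{F}_{\mathsf{lo}(\mathtt{n})}\cup\{\{\mathsf{lb}(\mathtt{n})\}\cup S\mid S\in\mathcal{F}_{\mathsf{hi}(\mathtt{n})}\}$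 otherwise; the ZDD represents the family of its root. The reduced ZDD (obtained by merging nodes with identical label and children and deleting nodes whose hi-child is $\bot$) is the unique smallest ZDD for the family and order; $Z_<(\mathcal{F})$ is its number of nodes. Asymptotics are as $m\to\infty$. *)

(* Defs.v *)
From HB Require Import structures.
From mathcomp Require Import all_boot all_order all_algebra.

Set Implicit Arguments.
Unset Strict Implicit.
Unset Printing Implicit Defensive.

Import Order.TTheory.

Definition maximal_sets (T : finType) (F : {set {set T}}) : {set {set T}} :=
  [set A in F | [forall B in F, (A \subset B) ==> (A == B)]].

Definition minimal_sets (T : finType) (F : {set {set T}}) : {set {set T}} :=
  [set A in F | [forall B in F, (B \subset A) ==> (A == B)]].

Variant extremal_op := Maximal | Minimal.

Definition apply_op (op : extremal_op) (T : finType) (F : {set {set T}}) :=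
  match op with
  | Maximal => maximal_sets F
  | Minimal => minimal_sets F
  end.

(* The vertices of a ZDD are [bool + inode]: [inl true] is the terminal top,  *)
(* [inl false] the terminal bot, and [inr n] an internal node.  Acyclicity    *)
(* follows from [lo_lt] and [hi_lt].                                          *)
Record zdd (d : Order.disp_t) (U : finOrderType d) := Zdd {
  inode : finType;
  lb : inode -> U;
  lo : inode -> bool + inode;
  hi : inode -> bool + inode;
  root : bool + inode;
  lo_lt : forall n n', lo n = inr n' -> (lb n < lb n')%O;
  hi_lt : forall n n', hi n = inr n' -> (lb n < lb n')%O
}.

Notation vertex D := (bool + inode D)%type.

Definition nb_nodes (d : Order.disp_t) (U : finOrderType d) (D : zdd U) : nat :=
  #|{: vertex D}|.

(* Labels increase strictly along arcs, so recursion depth #|U| is enough;    *)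
(* the defining equations, without the bound, are [fam_top], [fam_bot] and    *)
(* [fam_inode].                                                               *)
Fixpoint fam_rec (d : Order.disp_t) (U : finOrderType d) (D : zdd U) (k : nat)
    (v : vertex D) : {set {set U}} :=
  match v, k with
  | inl true, _ => [set set0]
  | inl false, _ => set0
  | inr n, k'.+1 =>
      fam_rec k' (lo n) :|: [set lb n |: S | S in fam_rec k' (hi n)]
  | inr _, 0 => set0
  end.

Definition fam (d : Order.disp_t) (U : finOrderType d) (D : zdd U)
  (v : vertex D) : {set {set U}} := fam_rec #|U| v.

Definition represents (d : Order.disp_t) (U : finOrderType d) (D : zdd U)
  (F : {set {set U}}) : Prop := fam (root D) = F.

Definition arc (d : Order.disp_t) (U : finOrderType d) (D : zdd U) :
    rel (vertex D) :=
  fun v w => if v is inr n then (w == lo n) || (w == hi n) else false.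

(* No node can be merged with another one, none can be deleted, and every     *)
(* internal node is reachable from the root.                                  *)
Definition reduced (d : Order.disp_t) (U : finOrderType d) (D : zdd U) : Prop :=
  [/\ injective (fun n : inode D => (lb n, lo n, hi n)),
      forall n : inode D, hi n <> inl false
    & forall n : inode D, connect (@arc d U D) (root D) (inr n)].

Lemma fam_top (d : Order.disp_t) (U : finOrderType d) (D : zdd U) :
  fam (inl true : vertex D) = [set set0].
Proof. by rewrite /fam; case: #|U|. Qed.

Lemma fam_bot (d : Order.disp_t) (U : finOrderType d) (D : zdd U) :
  fam (inl false : vertex D) = set0.
Proof. by rewrite /fam; case: #|U|. Qed.

Definition vrank (d : Order.disp_t) (U : finOrderType d) (D : zdd U)
    (v : vertex D) : nat :=
  if v is inr n then #|[set y | (lb n <= y)%O]| else 0.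

Lemma vrank_lt (d : Order.disp_t) (U : finOrderType d) (D : zdd U)
    (n : inode D) (v : vertex D) :
  (forall n', v = inr n' -> (lb n < lb n')%O) -> vrank v < vrank (inr n).
Proof.
case: v => [b _|n' /(_ n' erefl) ltn] /=.
  by apply/card_gt0P; exists (lb n); rewrite inE lexx.
apply/proper_card/properP; split.
  by apply/subsetP => y; rewrite !inE; apply: le_trans (ltW ltn).
by exists (lb n); rewrite !inE ?lexx // -ltNge.
Qed.

Lemma vrank_lo (d : Order.disp_t) (U : finOrderType d) (D : zdd U)
  (n : inode D) : vrank (lo n) < vrank (inr n).
Proof. by apply: vrank_lt => n'; apply: lo_lt. Qed.

Lemma vrank_hi (d : Order.disp_t) (U : finOrderType d) (D : zdd U)
  (n : inode D) : vrank (hi n) < vrank (inr n).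
Proof. by apply: vrank_lt => n'; apply: hi_lt. Qed.

Lemma vertex_ind (d : Order.disp_t) (U : finOrderType d) (D : zdd U)
    (P : vertex D -> Prop) :
  P (inl true) -> P (inl false) ->
  (forall n, P (lo n) -> P (hi n) -> P (inr n)) -> forall v, P v.
Proof.
move=> Pt Pf Pn v; have [k] := ubnP (vrank v).
elim: k v => // k IH [[]|n] // lek.
apply: Pn; apply: IH; rewrite -ltnS; apply: leq_trans lek.
  by rewrite ltnS; apply: vrank_lo.
by rewrite ltnS; apply: vrank_hi.
Qed.

Lemma fam_rec_stable (d : Order.disp_t) (U : finOrderType d) (D : zdd U)
    (v : vertex D) (k k' : nat) :
  vrank v <= k -> vrank v <= k' -> fam_rec k v = fam_rec k' v.
Proof.
elim/vertex_ind: v k k' => [||n IHl IHh] [|k] [|k'] //.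
- by move=> /(leq_trans (vrank_lo n)).
- by move=> _ /(leq_trans (vrank_lo n)).
move=> lek lek' /=; have [ltl lth] := (vrank_lo n, vrank_hi n).
rewrite (IHl k k') ?(IHh k k') // -ltnS;
  by [apply: leq_trans lek | apply: leq_trans lek'].
Qed.

Lemma fam_inode (d : Order.disp_t) (U : finOrderType d) (D : zdd U)
    (n : inode D) :
  fam (inr n) = fam (lo n) :|: [set lb n |: S | S in fam (hi n)].
Proof.
rewrite {1}/fam (@fam_rec_stable _ _ _ _ _ #|U|.+1) ?max_card //.
by apply: leqW; apply: max_card.
Qed.

(* Cofactors of a family with respect to an element.                          *)
Definition off (T : finType) (x : T) (F : {set {set T}}) : {set {set T}} :=
  [set S in F | x \notin S].

Definition on (T : finType) (x : T) (F : {set {set T}}) : {set {set T}} :=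
  [set S :\ x | S in F & x \in S].

Lemma onP (T : finType) (x : T) (F : {set {set T}}) (S : {set T}) :
  reflect (x \notin S /\ x |: S \in F) (S \in on x F).
Proof.
apply: (iffP imsetP) => [[A]|[xS xSF]].
  by rewrite inE => /andP[AF xA] ->; rewrite setD11 setD1K.
by exists (x |: S); rewrite ?inE ?xSF ?eqxx // setU1K.
Qed.

Lemma off_on (T : finType) (x : T) (F : {set {set T}}) :
  off x F :|: [set x |: S | S in on x F] = F.
Proof.
apply/setP => S; rewrite !inE; apply/idP/idP.
  by case/orP=> [/andP[] //|/imsetP[A /onP[_ AF] ->]].
move=> SF; rewrite SF /=; case: (boolP (x \in S)) => //= xS.
apply/imsetP; exists (S :\ x); last by rewrite setD1K.
by apply/onP; rewrite setD11 setD1K.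
Qed.

Lemma fam_lb_le (d : Order.disp_t) (U : finOrderType d) (D : zdd U)
    (v : vertex D) (x : U) :
  (forall n, v = inr n -> (x <= lb n)%O) ->
  forall S y, S \in fam v -> y \in S -> (x <= y)%O.
Proof.
elim/vertex_ind: v x => [||n IHl IHh] x.
- by move=> _ S y; rewrite fam_top inE => /eqP ->; rewrite inE.
- by move=> _ S y; rewrite fam_bot inE.
move=> /(_ n erefl) lexn S y; rewrite fam_inode inE => /orP[].
  by apply: IHl => n' /lo_lt /ltW; apply: le_trans.
case/imsetP=> A AF ->; rewrite !inE => /predU1P[-> //|].
by apply: IHh AF => n' /hi_lt /ltW; apply: le_trans.
Qed.

Lemma fam_lb_lt (d : Order.disp_t) (U : finOrderType d) (D : zdd U)
    (v : vertex D) (x : U) :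
  (forall n, v = inr n -> (x < lb n)%O) ->
  forall S y, S \in fam v -> y \in S -> (x < y)%O.
Proof.
case: v => [[]|n] ltx S y.
- by rewrite fam_top inE => /eqP ->; rewrite inE.
- by rewrite fam_bot inE.
move=> Sn yS; apply: lt_le_trans (ltx n erefl) _.
by apply: fam_lb_le Sn yS => n' [->].
Qed.

Lemma fam_child_notin (d : Order.disp_t) (U : finOrderType d) (D : zdd U)
    (n : inode D) (S : {set U}) :
  (S \in fam (lo n)) || (S \in fam (hi n)) -> lb n \notin S.
Proof.
move=> SF; apply/negP => nS; suff: (lb n < lb n)%O by rewrite ltxx.
by case/orP: SF => SF; apply: fam_lb_lt SF nS => n'; [apply: lo_lt|apply: hi_lt].
Qed.

Lemma fam_lo (d : Order.disp_t) (U : finOrderType d) (D : zdd U)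
  (n : inode D) : fam (lo n) = off (lb n) (fam (inr n)).
Proof.
apply/setP => S; rewrite inE fam_inode inE; apply/idP/idP.
  by move=> Sl; rewrite Sl (fam_child_notin (n := n)) // Sl.
by case/andP=> /orP[//|/imsetP[A _ ->]]; rewrite !inE eqxx.
Qed.

Lemma fam_hi (d : Order.disp_t) (U : finOrderType d) (D : zdd U)
  (n : inode D) : fam (hi n) = on (lb n) (fam (inr n)).
Proof.
apply/setP => S; rewrite fam_inode; apply/idP/onP.
  move=> Sh; split; first by apply: fam_child_notin; rewrite Sh orbT.
  by rewrite inE [X in _ || X](_ : _ = true) ?orbT //; apply/imsetP; exists S.
case=> nS; rewrite inE => /orP[Sl|/imsetP[A Ah]].
  have := @fam_child_notin _ _ _ n (lb n |: S); rewrite Sl => /(_ isT).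
  by rewrite !inE eqxx.
have nA : lb n \notin A by apply: fam_child_notin; rewrite Ah orbT.
by move=> /(congr1 (fun B => B :\ lb n)); rewrite !setU1K // => ->.
Qed.

Lemma reduced_fam0 (d : Order.disp_t) (U : finOrderType d) (D : zdd U)
  (v : vertex D) : reduced D -> fam v = set0 -> v = inl false.
Proof.
case=> _ hiN _; elim/vertex_ind: v => [||n _ IHh] //.
  by rewrite fam_top => /setP /(_ set0); rewrite !inE eqxx.
move=> Fn; case: (hiN n); apply: IHh.
by rewrite fam_hi Fn; apply/setP => S; rewrite inE; apply/onP; rewrite inE => -[].
Qed.

Lemma reduced_lb_mem (d : Order.disp_t) (U : finOrderType d) (D : zdd U)
  (n : inode D) : reduced D -> exists2 S, S \in fam (inr n) & lb n \in S.
Proof.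
move=> rD; have: fam (hi n) != set0.
  by apply/eqP => /(reduced_fam0 rD) hn; case: rD => _ /(_ n).
case/set0Pn=> S; rewrite fam_hi => /onP[_ SF]; exists (lb n |: S) => //.
by rewrite !inE eqxx.
Qed.

Lemma reduced_match (d : Order.disp_t) (U : finOrderType d) (D E : zdd U)
    (n : inode D) (w : vertex E) :
  reduced D -> fam w = fam (inr n) ->
  exists2 n' : inode E, lb n' = lb n & fam (inr n') = fam (inr n).
Proof.
move=> rD; have [S SF nS] := reduced_lb_mem n rD.
elim/vertex_ind: w => [||n' IHl _] Fw.
- by move: SF nS; rewrite -Fw fam_top inE => /eqP ->; rewrite inE.
- by move: SF; rewrite -Fw fam_bot inE.
have: (lb n' <= lb n)%O.
  by move: SF; rewrite -Fw => SF; apply: fam_lb_le SF nS => ? [->].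
rewrite le_eqVlt => /predU1P[eqn|ltn]; first by exists n'.
apply: IHl; rewrite fam_lo Fw; apply/setP => A; rewrite inE andb_idr // => AF.
apply/negP => nA; suff: (lb n <= lb n')%O by rewrite leNgt ltn.
by apply: fam_lb_le AF nA => ? [->].
Qed.

Lemma reduced_fam_inj (d : Order.disp_t) (U : finOrderType d) (D : zdd U) :
  reduced D -> injective (@fam d U D).
Proof.
move=> rD; have mem n := reduced_lb_mem n rD.
elim/vertex_ind=> [||n IHl IHh] w Fw.
- case: w Fw => [[]|n] // /eqP.
    by rewrite fam_top fam_bot => /eqP /setP /(_ set0); rewrite !inE eqxx.
  case: (mem n) => S SF nS /eqP Fn; move: SF nS.
  by rewrite -Fn fam_top inE => /eqP ->; rewrite inE.
- by apply/esym/(reduced_fam0 rD); rewrite -Fw fam_bot.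
have [S SF nS] := mem n.
case: w Fw => [[]|n'] Fn.
- by move: SF nS; rewrite Fn fam_top inE => /eqP ->; rewrite inE.
- by move: SF; rewrite Fn fam_bot inE.
have [S' SF' nS'] := mem n'.
have eqn : lb n = lb n'.
  apply/le_anti/andP; split.
    by move: SF'; rewrite -Fn => SF'; apply: fam_lb_le SF' nS' => ? [->].
  by move: SF; rewrite Fn => SF; apply: fam_lb_le SF nS => ? [->].
congr inr; case: (rD) => inj _ _; apply: inj.
by rewrite eqn; congr (_, _, _); [apply: IHl; rewrite !fam_lo eqn Fn
                                 |apply: IHh; rewrite !fam_hi eqn Fn].
Qed.

Lemma connect_ind_r (T : finType) (e : rel T) (x : T) (P : T -> Prop) :
  P x -> (forall y z, connect e x y -> P y -> e y z -> P z) ->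
  forall y, connect e x y -> P y.
Proof.
move=> Px Pe y /connectP[p]; elim/last_ind: p y => [|p z IH] y /=.
  by move=> _ ->.
rewrite rcons_path last_rcons => /andP[ep ez] ->.
by apply: Pe ez; [apply/connectP; exists p|apply: IH].
Qed.

Lemma reduced_cover (d : Order.disp_t) (U : finOrderType d) (D E : zdd U) :
  reduced D -> fam (root D) = fam (root E) ->
  forall n : inode D, exists n' : inode E, fam (inr n') = fam (inr n).
Proof.
move=> rD FDE n; case: (rD) => _ _ /(_ n) Dn.
suff [w /(reduced_match rD)[n' _ Fn']] : exists w : vertex E, fam w = fam (inr n).
  by exists n'.
move: (inr n : vertex D) Dn; apply: connect_ind_r; first by exists (root E).
move=> [b|m] z _ [w Fw] //= zm; have [n' en Fn'] := reduced_match rD Fw.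
case/orP: zm => /eqP ->.
  by exists (lo n'); rewrite !fam_lo en Fn'.
by exists (hi n'); rewrite !fam_hi en Fn'.
Qed.

Lemma reduced_smallest (d : Order.disp_t) (U : finOrderType d) (D E : zdd U)
    (F : {set {set U}}) :
  reduced D -> represents D F -> represents E F -> nb_nodes D <= nb_nodes E.
Proof.
move=> rD FD FE; rewrite /nb_nodes !card_sum leq_add2l.
have injD : injective (fun n : inode D => fam (inr n)).
  by move=> n n' /(reduced_fam_inj rD) [].
rewrite -(card_codom injD).
apply: leq_trans (leq_imset_card (fun n : inode E => fam (inr n)) _).
apply: subset_leq_card; apply/subsetP => _ /codomP[n ->].
have [n' <-] := reduced_cover rD (etrans FD (esym FE)) n.
by apply/imsetP; exists n'.
Qed.

Definition topvar (d : Order.disp_t) (U : finOrderType d) (F : {set {set U}}) :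
    option U :=
  [pick x in cover F | [forall y in cover F, (x <= y)%O]].

Lemma topvarP (d : Order.disp_t) (U : finOrderType d) (F : {set {set U}})
    (x : U) :
  topvar F = Some x ->
  (exists2 S, S \in F & x \in S) /\
  (forall S y, S \in F -> y \in S -> (x <= y)%O).
Proof.
rewrite /topvar; case: pickP => //= z /andP[/bigcupP[S SF zS] /forall_inP zm] [<-].
split; first by exists S.
by move=> A y AF yA; apply: zm; apply/bigcupP; exists A.
Qed.

Lemma topvarN (d : Order.disp_t) (U : finOrderType d) (F : {set {set U}}) :
  topvar F = None -> F = if set0 \in F then [set set0] else set0.
Proof.
rewrite /topvar; case: pickP => //= noF _.
have F0 S : S \in F -> S = set0.
  move=> SF; apply/eqP; apply: contraT => /set0Pn[x xS].
  have xF : x \in cover F by apply/bigcupP; exists S.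
  case: (arg_minP id xF) => z zF zm.
  have /negP[] := negbT (noF z).
  by apply/andP; split=> //; apply/forall_inP => y yF; apply: zm.
apply/setP => S; case: ifP => F0F; rewrite !inE.
  by apply/idP/eqP => [/F0|->].
by apply/negP => SF; move: F0F; rewrite -(F0 S SF) SF.
Qed.

Definition cofactor_step (d : Order.disp_t) (U : finOrderType d) :
    rel {set {set U}} :=
  fun F G => if topvar F is Some x then (G == off x F) || (G == on x F)
             else false.

Definition sub_node (d : Order.disp_t) (U : finOrderType d)
    (F : {set {set U}}) : finType :=
  {p : U * {set {set U}} |
    (topvar p.2 == Some p.1) && connect (@cofactor_step d U) F p.2}.

Definition sub_vertex (d : Order.disp_t) (U : finOrderType d)
    (F G : {set {set U}}) : bool + sub_node F :=
  if topvar G is Some x then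
    if insub (x, G) is Some n then inr n else inl true
  else inl (set0 \in G).

Lemma sub_vertex_inr (d : Order.disp_t) (U : finOrderType d)
    (F G : {set {set U}}) (n : sub_node F) :
  sub_vertex F G = inr n -> (val n).2 = G.
Proof.
rewrite /sub_vertex; case: (topvar G) => // x.
by case: insubP => // m _ em [<-]; rewrite em.
Qed.

Lemma sub_vertexK (d : Order.disp_t) (U : finOrderType d)
    (F : {set {set U}}) (n : sub_node F) : sub_vertex F (val n).2 = inr n.
Proof.
have /andP[/eqP tn _] := valP n; rewrite /sub_vertex tn -surjective_pairing.
by rewrite valK.
Qed.

Lemma sub_node_lo_lt (d : Order.disp_t) (U : finOrderType d)
    (F : {set {set U}}) (n n' : sub_node F) :
  sub_vertex F (off (val n).1 (val n).2) = inr n' ->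
  ((val n).1 < (val n').1)%O.
Proof.
move/sub_vertex_inr => en'.
have /andP[/eqP /topvarP[_ mn] _] := valP n.
have /andP[/eqP /topvarP[[S Sn' xS] _] _] := valP n'.
move: Sn'; rewrite en' inE => /andP[SF nS].
rewrite lt_neqAle (mn S) // andbT; apply: contraNneq nS => ->; exact: xS.
Qed.

Lemma sub_node_hi_lt (d : Order.disp_t) (U : finOrderType d)
    (F : {set {set U}}) (n n' : sub_node F) :
  sub_vertex F (on (val n).1 (val n).2) = inr n' ->
  ((val n).1 < (val n').1)%O.
Proof.
move/sub_vertex_inr => en'.
have /andP[/eqP /topvarP[_ mn] _] := valP n.
have /andP[/eqP /topvarP[[S Sn' xS] _] _] := valP n'.
move: Sn'; rewrite en' => /onP[nS SF].
rewrite lt_neqAle (mn _ _ SF) ?inE ?xS ?orbT // andbT.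
by apply: contraNneq nS => ->; exact: xS.
Qed.

Definition sub_zdd (d : Order.disp_t) (U : finOrderType d)
    (F : {set {set U}}) : zdd U :=
  @Zdd d U (sub_node F) (fun n => (val n).1)
    (fun n => sub_vertex F (off (val n).1 (val n).2))
    (fun n => sub_vertex F (on (val n).1 (val n).2))
    (sub_vertex F F) (@sub_node_lo_lt d U F) (@sub_node_hi_lt d U F).

Lemma fam_sub_vertex (d : Order.disp_t) (U : finOrderType d)
    (F G : {set {set U}}) :
  connect (@cofactor_step d U) F G ->
  fam (sub_vertex F G : vertex (sub_zdd F)) = G.
Proof.
move: {2}(sub_vertex F G : vertex (sub_zdd F)) (erefl (sub_vertex F G)) => v.
elim/vertex_ind: v G => [||n IHl IHh] G eG cG.
- move: (eG); rewrite /sub_vertex; case tG: (topvar G) => [x|].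
    by rewrite insubT //= tG eqxx.
  by case=> G0; rewrite [RHS](topvarN tG) G0 fam_top.
- move: (eG); rewrite /sub_vertex; case tG: (topvar G) => [x|].
    by rewrite insubT //= tG eqxx.
  by case=> G0; rewrite [RHS](topvarN tG) G0 fam_bot.
have nG := sub_vertex_inr eG.
have /andP[/eqP tn _] := valP n.
rewrite eG fam_inode (IHl _ erefl) ?(IHh _ erefl) ?nG; first exact: off_on.
- apply: connect_trans cG (connect1 _).
  by rewrite /cofactor_step -nG tn eqxx orbT.
- apply: connect_trans cG (connect1 _).
  by rewrite /cofactor_step -nG tn eqxx.
Qed.

Lemma sub_zdd_represents (d : Order.disp_t) (U : finOrderType d)
  (F : {set {set U}}) : represents (sub_zdd F) F.
Proof. by rewrite /represents fam_sub_vertex. Qed.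

Lemma fam_sub_inode (d : Order.disp_t) (U : finOrderType d)
  (F : {set {set U}}) (n : inode (sub_zdd F)) : fam (inr n) = (val n).2.
Proof.
have /andP[_ cn] := valP n.
by rewrite -[RHS](fam_sub_vertex cn) sub_vertexK.
Qed.

Lemma sub_zdd_reduced (d : Order.disp_t) (U : finOrderType d)
  (F : {set {set U}}) : reduced (sub_zdd F).
Proof.
split=> [n n' [el eL eH]|n hn|n].
- apply: val_inj; rewrite [val n]surjective_pairing [val n']surjective_pairing.
  congr pair; first exact: el.
  rewrite -!fam_sub_inode !fam_inode /=.
  by rewrite [sub_vertex F (off _ _)]eL [sub_vertex F (on _ _)]eH el.
- have /andP[/eqP /topvarP[[S SF nS] _] _] := valP n.
  have := fam_hi n; rewrite hn fam_bot fam_sub_inode /=.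
  move/setP/(_ (S :\ (val n).1)); rewrite inE => /esym/negP[].
  by apply/onP; rewrite setD11 setD1K.
have /andP[_ cn] := valP n.
have -> : inr n = sub_vertex F (val n).2 by rewrite sub_vertexK.
move: {n} (val n).2 cn; apply: connect_ind_r => [|G H cG IH]; first exact: connect0.
rewrite /cofactor_step; case tG: (topvar G) => [x|] // eH.
apply: connect_trans IH (connect1 _).
have xG : (topvar (x, G).2 == Some (x, G).1) &&
          connect (@cofactor_step d U) F (x, G).2 by rewrite /= tG eqxx.
rewrite {1}/sub_vertex tG insubT /=.
by case/orP: eH => /eqP ->; rewrite eqxx ?orbT.
Qed.

Lemma reduced_zdd (d : Order.disp_t) (U : finOrderType d)
  (F : {set {set U}}) : {D : zdd U | reduced D /\ represents D F}.
Proof.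
by exists (sub_zdd F); split; [apply: sub_zdd_reduced|apply: sub_zdd_represents].
Qed.

Definition Z (d : Order.disp_t) (U : finOrderType d) (F : {set {set U}}) : nat :=
  nb_nodes (sval (reduced_zdd F)).

(* [Z] does not depend on the choice of the reduced ZDD, and it is the        *)
(* smallest size of a ZDD for the family.                                     *)
Lemma Z_reduced (d : Order.disp_t) (U : finOrderType d) (F : {set {set U}})
  (D : zdd U) : reduced D -> represents D F -> nb_nodes D = Z F.
Proof.
rewrite /Z; case: reduced_zdd => E [rE FE] /= rD FD.
by apply/eqP; rewrite eqn_leq !(reduced_smallest (F := F)).
Qed.

Lemma Z_smallest (d : Order.disp_t) (U : finOrderType d) (F : {set {set U}})
  (D : zdd U) : represents D F -> Z F <= nb_nodes D.
Proof.
by rewrite /Z; case: reduced_zdd => E [rE FE] /=; apply: reduced_smallest.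
Qed.

Definition bigO (f g : nat -> nat) : Prop :=
  exists C m0 : nat, forall m, m0 <= m -> f m <= C * g m.

Local Open Scope ring_scope.

(* Positivity of p matters: x / 0 = 0, and a negative p would make the bound  *)
(* vacuous.                                                                   *)
Definition exp2_over_poly_lower_bound (f : nat -> nat) : Prop :=
  exists (p : {poly rat}) (m0 : nat), forall m : nat, (m0 <= m)%N ->
    0 < p.[m%:R] /\ 2%:R ^+ m / p.[m%:R] <= (f m)%:R.

(* Main.v *)
Require Import Defs.
From HB Require Import structures.
From mathcomp Require Import all_boot all_order all_algebra.
From mathcomp Require Import zify.

(* Over the ordered ground set x_1 < ... < x_m < y_1 < ... < y_m < z, let F   *)
(* consist of all sets of size m + 1 and of the m pairs {x_i, y_i}.  A        *)
(* cofactor of F is determined by the next variable, by the number of         *)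
(* elements chosen so far, and by at most one pair compatible with that       *)
(* choice, so F has a ZDD of size O(m^3).  For a, b in {1..m}, the set        *)
(* x_a + y_(complement of b) + z is minimal in F iff a = b: it contains a     *)
(* pair unless a is included in b, and its size is m + 1 iff |a| = |b|.       *)
(* Hence the minimal sets have 2^m distinct cofactors at the cut between the  *)
(* x_i and the y_i.  For maximal sets, complement every member of F.          *)

Set Implicit Arguments.
Unset Strict Implicit.
Unset Printing Implicit Defensive.

Import Order.TTheory.

(** Both bounds count cofactors. A nonterminal cofactor reached from [F] is fixed by its top
    variable and the set [P] of elements chosen before it ([reachable_cofactor]). When [F] is a
    uniform family plus few sets, few such families differ ([Z_uniform_union_le]). Conversely,
    prefixes that suffixes tell apart at a cut of the order lead to distinct vertices
    ([Z_fooling_ge]), and [minimal_hard_family] supplies [2 ^ m] of them. Complementation carries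
    both bounds over to maximal sets. *)

(** * Upper bound: counting cofactors *)

Lemma reachable_cofactor (d : Order.disp_t) (U : finOrderType d)
    (F G : {set {set U}}) :
  connect (@cofactor_step d U) F G ->
  forall x, topvar G = Some x ->
  exists2 P : {set U}, P \subset [set y | (y < x)%O] &
    G = [set S : {set U} | (S \subset [set y | (x <= y)%O]) && (P :|: S \in F)].
Proof.
move: G; apply: connect_ind_r => [x /topvarP[_ leF]|G G' _ IH].
  exists set0; first exact: sub0set.
  apply/setP => S; rewrite inE set0U andb_idl // => SF.
  by apply/subsetP => y yS; rewrite inE; apply: leF SF yS.
rewrite /cofactor_step; case tG: (topvar G) => [x|] // eG' x' tG'.
have [P ltP defG] := IH _ tG; have [_ leG] := topvarP tG.
have [[S0 S0G' x'S0] leG'] := topvarP tG'.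
have ltP' y : y \in P -> (y < x)%O by move/(subsetP ltP); rewrite inE.
have ltx : (x < x')%O.
  case/orP: eG' S0G' => /eqP->.
    rewrite inE => /andP[/leG/(_ x'S0) le_x].
    by rewrite lt_neqAle le_x andbT; apply: contraNneq => ->.
  case/onP=> xS0 /(leG _ x'); rewrite inE x'S0 orbT => /(_ isT).
  by rewrite le_eqVlt => /predU1P[ex|//]; rewrite ex x'S0 in xS0.
have notin (S : {set U}) : S \subset [set y | (x' <= y)%O] -> x \notin S.
  by move=> sS; apply/negP => /(subsetP sS); rewrite inE leNgt ltx.
have geS (S : {set U}) : S \subset [set y | (x' <= y)%O] -> S \subset [set y | (x <= y)%O].
  move=> sS; apply/subsetP=> y /(subsetP sS); rewrite !inE.
  by apply: le_trans (ltW ltx).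
have sG' S : S \in G' -> S \subset [set y | (x' <= y)%O].
  by move=> SG'; apply/subsetP => y yS; rewrite inE; apply: leG' yS.
(* An [off] step keeps [P], an [on] step adds [x] to it. Variables strictly between [x] and [x']
   occur in no member of [G'], hence count as not chosen. *)
case/orP: eG' => /eqP eG'.
  exists P; first by apply/subsetP => y /ltP' lty; rewrite inE (lt_trans lty).
  apply/setP => S; rewrite [RHS]inE; apply/idP/andP.
    move=> SG'; split; first exact: sG'.
    by move: SG'; rewrite eG' inE defG inE => /andP[/andP[]].
  by case=> sS SF; rewrite eG' inE defG inE geS // SF notin.
exists (x |: P).
  apply/subsetP => y; rewrite !inE => /predU1P[-> //|/ltP' lty].
  exact: lt_trans ltx.
apply/setP => S; rewrite [RHS]inE; apply/idP/andP.
  move=> SG'; split; first exact: sG'.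
  move: SG'; rewrite eG' => /onP[_]; rewrite defG inE => /andP[_].
  by rewrite setUCA setUA.
case=> sS SF; rewrite eG'; apply/onP; split; first exact: notin.
rewrite defG inE; apply/andP; split; last by rewrite setUCA setUA.
by rewrite subUset sub1set inE lexx geS.
Qed.

(** The uniform part sees only the size of [P]. A set of [H] matters only if its trace below the top
    variable is [P], and one such set determines [P]. So a variable, a size and an optional member
    of [H] encode each internal node; the 2 counts the terminals. *)
Lemma Z_uniform_union_le (d : Order.disp_t) (U : finOrderType d) (k : nat)
    (H : {set {set U}}) :
  Z ([set S : {set U} | #|S| == k] :|: H) <= 2 + #|U| * #|U|.+1 * #|H|.+1.
Proof.
set F := _ :|: H.
rewrite -(Z_reduced (sub_zdd_reduced F) (sub_zdd_represents F)).
rewrite /nb_nodes card_sum card_bool leq_add2l.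
pose decode (c : U * 'I_#|U|.+1 * option {h | h \in H}) :=
  (c.1.1, [set S : {set U} | (S \subset [set y | (c.1.1 <= y)%O]) &&
    ((c.1.2 + #|S| == k) ||
     (if c.2 is Some h then
        (val h :&: [set y | (y < c.1.1)%O]) :|: S \in H else false))]).
have -> : #|U| * #|U|.+1 * #|H|.+1 = #|{: U * 'I_#|U|.+1 * option {h | h \in H}}|.
  by rewrite !card_prod card_option card_ord card_sig.
apply: leq_trans (leq_imset_card decode _).
rewrite -(card_imset predT (val_inj : injective (val : sub_node F -> _))).
apply/subset_leq_card/subsetP => _ /imsetP[n _ ->].
have /andP[/eqP tn cn] := valP n; case: (val n) tn cn => x G /= tG cG.
have [P ltP ->] := reachable_cofactor cG tG.
have ltc : #|P| < #|U|.+1 by rewrite ltnS max_card.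
have PS (S : {set U}) : S \subset [set y | (x <= y)%O] -> P :&: S = set0.
  move=> geS; apply/setP => y; rewrite !inE; apply/negP => /andP[].
  by move=> /(subsetP ltP) + /(subsetP geS); rewrite !inE leNgt => ->.
have cardPS (S : {set U}) : S \subset [set y | (x <= y)%O] -> #|P :|: S| = #|P| + #|S|.
  by move=> /PS PS0; rewrite cardsU PS0 cards0 subn0.
case: (pickP [pred h in H | h :&: [set y | (y < x)%O] == P]) => [h|noh].
  case/andP=> hH /eqP eP; apply/imsetP.
  exists (x, Ordinal ltc, Some (exist _ h hH)) => //; congr pair.
  apply/setP => S; rewrite !inE /= eP.
  by case: (boolP (S \subset _)) => //= /cardPS ->.
apply/imsetP; exists (x, Ordinal ltc, None) => //; congr pair.
apply/setP => S; rewrite !inE /= orbF.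
case: (boolP (S \subset _)) => //= geS; rewrite cardPS //.
case: (boolP (P :|: S \in H)) => [PSH|_]; last by rewrite orbF.
(* A member [P :|: S] of [H] would have trace [P] below [x]. *)
have /negP[] := negbT (noh (P :|: S)); rewrite /= PSH /= setIUl.
rewrite (setIidPl ltP) [X in P :|: X](_ : _ = set0) ?setU0 //.
apply/setP => y; rewrite !inE; apply/negP => /andP[/(subsetP geS)].
by rewrite inE leNgt => /negbTE ->.
Qed.

(** * Lower bound: fooling sets at a cut of the order *)

(** Walk down from [v], taking [hi] exactly at labels in [P], until the label leaves [A]. An element
    of [P] skipped on the way leads to the bot terminal. *)
Lemma vertex_of_prefix (d : Order.disp_t) (U : finOrderType d) (D : zdd U)
    (A : {set U}) :
  (forall x y : U, (x <= y)%O -> y \in A -> x \in A) ->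
  forall (v : vertex D) (P : {set U}), P \subset A ->
  exists w : vertex D,
    fam w = [set S : {set U} | (S \subset ~: A) && (P :|: S \in fam v)].
Proof.
move=> dA; elim/vertex_ind => [||n IHl IHh] P sP.
- have [->|nP] := eqVneq P set0.
    exists (inl true); rewrite fam_top; apply/setP => S; rewrite !inE set0U.
    by rewrite andb_idl // => /eqP ->; rewrite sub0set.
  exists (inl false); rewrite fam_bot fam_top; apply/setP => S; rewrite !inE.
  by rewrite setU_eq0 (negbTE nP) andbF.
- by exists (inl false); rewrite fam_bot; apply/setP => S; rewrite !inE andbF.
have [nA|nA] := boolP (lb n \in A).
  have notin (S : {set U}) : S \subset ~: A -> lb n \notin S.
    by move=> sS; apply/negP => /(subsetP sS); rewrite inE nA.
  have [nP|nP] := boolP (lb n \in P).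
    have [w Fw] := IHh (P :\ lb n) (subset_trans (subD1set _ _) sP).
    exists w; rewrite Fw; apply/setP => S; rewrite !inE.
    case: (boolP (S \subset _)) => //= /notin nS; rewrite fam_hi.
    have e : lb n |: ((P :\ lb n) :|: S) = P :|: S by rewrite setUA setD1K.
    by apply/onP/idP => [[_]|]; rewrite e // => ?; rewrite !inE eqxx (negbTE nS).
  have [w Fw] := IHl P sP; exists w; rewrite Fw; apply/setP => S; rewrite !inE.
  case: (boolP (S \subset _)) => //= /notin nS.
  by rewrite fam_lo inE !inE (negbTE nP) (negbTE nS) andbT.
(* As [A] is closed downwards, no member of this family meets [A]. *)
have geA S y : S \in fam (inr n) -> y \in S -> y \notin A.
  move=> Sn yS; apply: contra nA; apply: dA.
  by apply: fam_lb_le Sn yS => n' [->].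
have [->|/set0Pn[y yP]] := eqVneq P set0.
  exists (inr n); apply/setP => S; rewrite !inE set0U andb_idl // => Sn.
  by apply/subsetP => y yS; rewrite inE; apply: geA yS.
exists (inl false); rewrite fam_bot; apply/setP => S; rewrite !inE.
apply/esym/negP => /andP[_ /(geA _ y)]; rewrite inE yP => /(_ isT).
by rewrite (subsetP sP).
Qed.

Lemma Z_fooling_ge (d : Order.disp_t) (U : finOrderType d) (F : {set {set U}})
    (A : {set U}) (I : finType) (P Q : I -> {set U}) :
  (forall x y : U, (x <= y)%O -> y \in A -> x \in A) ->
  (forall i, P i \subset A) -> (forall i, Q i \subset ~: A) ->
  (forall i j, (P i :|: Q j \in F) = (i == j)) ->
  #|I| <= Z F.
Proof.
move=> dA sP sQ PQ; rewrite /Z; case: reduced_zdd => D [_ FD] /=.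
have ex i : exists w : vertex D,
    fam w == [set S : {set U} | (S \subset ~: A) && (P i :|: S \in F)].
  have [w] := vertex_of_prefix dA (Defs.root D) (sP i).
  by rewrite FD => /eqP; exists w.
pose f i := xchoose (ex i).
have fP i j : (Q j \in fam (f i)) = (i == j).
  by rewrite (eqP (xchooseP (ex i))) inE sQ PQ.
rewrite -(card_codom (f := f)) ?max_card // => i j eij.
by apply/eqP; rewrite -fP eij fP.
Qed.

(** * Complementation, which reverses inclusion *)

Definition compl_family {T : finType} (F : {set {set T}}) : {set {set T}} :=
  [set ~: S | S in F].

Lemma in_compl_family (T : finType) (F : {set {set T}}) (S : {set T}) :
  (~: S \in compl_family F) = (S \in F).
Proof. exact/mem_imset/setC_inj. Qed.

Lemma maximal_compl_family (T : finType) (F : {set {set T}}) :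
  maximal_sets (compl_family F) = compl_family (minimal_sets F).
Proof.
apply/setP => S; rewrite -[S]setCK; move: (~: S) => {}S.
rewrite in_compl_family !inE in_compl_family; congr (_ && _).
apply/forall_inP/forall_inP => min B.
  move=> BF; have := min (~: B); rewrite in_compl_family setCS => /(_ BF).
  by rewrite (inj_eq (@setC_inj T)).
rewrite -[B]setCK in_compl_family setCS (inj_eq (@setC_inj T)); exact: min.
Qed.

(** * The hard family *)

Section HardFamily.

Variable m : nat.

Notation U := 'I_(m + m).+1.

Definition xvar (i : 'I_m) : U := inord i.
Definition yvar (i : 'I_m) : U := inord (m + i).
Definition zvar : U := ord_max.

Lemma val_xvar i : xvar i = i :> nat.
Proof. by rewrite inordK //; have := ltn_ord i; lia. Qed.

Lemma val_yvar i : yvar i = m + i :> nat.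
Proof. by rewrite inordK //; have := ltn_ord i; lia. Qed.

Lemma xvar_inj : injective xvar.
Proof. by move=> i j /(congr1 val) /=; rewrite !val_xvar => /val_inj. Qed.

Lemma yvar_inj : injective yvar.
Proof. by move=> i j /(congr1 val) /=; rewrite !val_yvar => /addnI/val_inj. Qed.

Lemma xvar_neq_yvar i j : (xvar i == yvar j) = false.
Proof. by apply/negP => /eqP/(congr1 val) /=; rewrite val_xvar val_yvar; have := ltn_ord i; lia. Qed.

Lemma zvar_neq_xvar i : (zvar == xvar i) = false.
Proof. by apply/negP => /eqP/(congr1 val) /=; rewrite val_xvar; have := ltn_ord i; lia. Qed.

Lemma zvar_neq_yvar i : (zvar == yvar i) = false.
Proof. by apply/negP => /eqP/(congr1 val) /=; rewrite val_yvar; have := ltn_ord i; lia. Qed.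

Definition xy_pairs : {set {set U}} := [set [set xvar i; yvar i] | i : 'I_m].

Definition hard_family : {set {set U}} :=
  [set S : {set U} | #|S| == m.+1] :|: xy_pairs.

Definition x_prefix (a : {set 'I_m}) : {set U} := xvar @: a.

(** Complementing [b] makes the pair of index [i] lie in the union of [x_prefix a] and [yz_suffix b]
    iff [i] is in [a] but not in [b]. As [zvar] lies in no pair, the union is never itself a
    pair. *)
Definition yz_suffix (b : {set 'I_m}) : {set U} := zvar |: yvar @: ~: b.

Definition x_vars : {set U} := [set j : U | j < m].

Lemma xvar_in i a b : (xvar i \in x_prefix a :|: yz_suffix b) = (i \in a).
Proof.
rewrite !inE eq_sym zvar_neq_xvar /= mem_imset; last exact: xvar_inj.
case: (i \in a) => //=; apply/imsetP => -[j _ /eqP].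
by rewrite xvar_neq_yvar.
Qed.

Lemma yvar_in i a b : (yvar i \in x_prefix a :|: yz_suffix b) = (i \notin b).
Proof.
rewrite !inE eq_sym zvar_neq_yvar /= mem_imset; last exact: yvar_inj.
rewrite inE orbC; case: (i \notin b) => //=; apply/imsetP => -[j _ /eqP].
by rewrite eq_sym xvar_neq_yvar.
Qed.

Lemma zvar_in a b : zvar \in x_prefix a :|: yz_suffix b.
Proof. by rewrite !inE eqxx orbT. Qed.

Lemma zvar_notin_pair i : zvar \notin [set xvar i; yvar i].
Proof. by rewrite !inE zvar_neq_xvar zvar_neq_yvar. Qed.

Lemma x_prefix_sub a : x_prefix a \subset x_vars.
Proof. by apply/subsetP => _ /imsetP[i _ ->]; rewrite inE val_xvar. Qed.

Lemma yz_suffix_sub b : yz_suffix b \subset ~: x_vars.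
Proof.
apply/subsetP => j; rewrite !inE => /predU1P[->|/imsetP[i _ ->]].
  by rewrite /= -leqNgt leq_addr.
by rewrite val_yvar -leqNgt leq_addr.
Qed.

Lemma card_prefix_suffix a b :
  #|x_prefix a :|: yz_suffix b| = #|a| + (m - #|b|).+1.
Proof.
rewrite cardsU [_ :&: _](_ : _ = set0); last first.
  apply/setP => j; rewrite [RHS]inE; apply/setIP => -[].
  by move=> /(subsetP (x_prefix_sub a)) + /(subsetP (yz_suffix_sub b)); rewrite !inE => ->.
rewrite cards0 subn0 (card_imset _ xvar_inj) cardsU1 (card_imset _ yvar_inj).
rewrite [zvar \in _](_ : _ = false); last first.
  by apply/imsetP => -[j _ /eqP]; rewrite zvar_neq_yvar.
by rewrite add1n -[X in X - #|b|](card_ord m) -(cardsC b) addKn.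
Qed.

Lemma minimal_hard_family a b :
  (x_prefix a :|: yz_suffix b \in minimal_sets hard_family) = (a == b).
Proof.
have le_m (c : {set 'I_m}) : #|c| <= m by rewrite -[leqRHS]card_ord max_card.
rewrite inE; apply/andP/eqP => [[abF /forall_inP min]|<-].
  (* Not being a pair, the union must have size [m.+1]. *)
  have cab : #|a| = #|b|.
    move: abF; rewrite !inE card_prefix_suffix => /orP[/eqP|].
      by have := le_m b; lia.
    case/imsetP=> i _ e; have := zvar_in a b; rewrite e.
    by rewrite (negbTE (zvar_notin_pair i)).
  apply/eqP; rewrite eqEcard cab leqnn andbT; apply/subsetP => i ia.
  apply: contraT => nib.
  have pF : [set xvar i; yvar i] \in hard_family.
    by apply/setUP; right; apply/imsetP; exists i.
  (* Minimality would make the union equal to this pair, which lacks [zvar]. *)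
  have := min _ pF; rewrite subUset !sub1set xvar_in yvar_in ia nib /=.
  move/eqP => e; have := zvar_in a b; rewrite e.
  by rewrite (negbTE (zvar_notin_pair i)).
have caa : #|x_prefix a :|: yz_suffix a| = m.+1.
  by rewrite card_prefix_suffix; have := le_m a; lia.
split; first by rewrite !inE caa eqxx.
apply/forall_inP => B; rewrite !inE => /orP[/eqP cB|/imsetP[i _ ->]].
  by apply/implyP => sB; rewrite eq_sym eqEcard sB caa cB leqnn.
by rewrite subUset !sub1set xvar_in yvar_in andbN.
Qed.

Lemma x_vars_closed (x y : U) :
  (x <= y)%O -> y \in x_vars -> x \in x_vars.
Proof. by rewrite !inE leEord; exact: leq_ltn_trans. Qed.

Lemma card_subsets : #|{: {set 'I_m}}| = 2 ^ m.
Proof. by rewrite -cardsT -powersetT card_powerset cardsT card_ord. Qed.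

Lemma Z_minimal_hard_family : 2 ^ m <= Z (minimal_sets hard_family).
Proof.
rewrite -card_subsets.
exact: Z_fooling_ge x_vars_closed x_prefix_sub yz_suffix_sub
         minimal_hard_family.
Qed.

Lemma Z_maximal_compl_hard_family :
  2 ^ m <= Z (maximal_sets (compl_family hard_family)).
Proof.
rewrite -card_subsets.
(* Complementing separately on each side of the cut makes [P a :|: Q b] the complement of the
   original union. *)
pose P a := x_vars :\: x_prefix a.
pose Q b := ~: x_vars :\: yz_suffix b.
apply: (@Z_fooling_ge _ _ _ x_vars _ P Q (@x_vars_closed)) => [a|b|a b].
- exact: subsetDl.
- exact: subsetDl.
have -> : P a :|: Q b = ~: (x_prefix a :|: yz_suffix b).
  rewrite /P /Q; move: (x_prefix_sub a) (yz_suffix_sub b).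
  move: (x_prefix a) (yz_suffix b) => X Y /subsetP sX /subsetP sY.
  apply/setP => j; move: (sX j) (sY j); rewrite !inE.
  move=> /implyP + /implyP.
  by case: (j \in X); case: (j \in Y); case: (j < m).
by rewrite maximal_compl_family in_compl_family minimal_hard_family.
Qed.

Lemma card_xy_pairs : #|xy_pairs| <= m.
Proof. by rewrite -[leqRHS]card_ord leq_imset_card. Qed.

Lemma Z_hard_family : Z hard_family <= 2 + (m + m).+1 * (m + m).+2 * m.+1.
Proof.
apply: leq_trans (Z_uniform_union_le _ _) _.
by rewrite card_ord leq_add2l leq_mul2l ltnS card_xy_pairs orbT.
Qed.

(** The ground set has [2m + 1] elements, so complements of sets of size [m + 1] have size [m]: the
    family is again uniform plus few sets. *)
Lemma compl_hard_family :
  compl_family hard_family =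
    [set S : {set U} | #|S| == m] :|: compl_family xy_pairs.
Proof.
rewrite /compl_family imsetU; congr (_ :|: _); apply/setP => S.
rewrite -[S]setCK in_compl_family !inE cardsCs card_ord setCK.
by have := max_card (~: S); rewrite card_ord; lia.
Qed.

Lemma Z_compl_hard_family :
  Z (compl_family hard_family) <= 2 + (m + m).+1 * (m + m).+2 * m.+1.
Proof.
rewrite compl_hard_family; apply: leq_trans (Z_uniform_union_le _ _) _.
rewrite card_ord leq_add2l leq_mul2l ltnS orbC.
by rewrite (leq_trans (leq_imset_card _ _)) ?card_xy_pairs.
Qed.

End HardFamily.

(** * Asymptotics and conclusion *)

Lemma cubic_bigO_m4 (f : nat -> nat) :
  (forall m, f m <= 2 + (m + m).+1 * (m + m).+2 * m.+1) ->
  bigO f (fun m => m ^ 4).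
Proof.
(* For [m >= 1] the product is at most [3m * 4m * 2m], that is [24 m^3]; the summand 2 raises the
   constant to 26. *)
move=> fle; exists 26, 1 => m m_gt0; apply: leq_trans (fle m) _.
have : (m + m).+1 * (m + m).+2 * m.+1 <= 3 * m * (4 * m) * (2 * m).
  by rewrite !leq_mul //; lia.
have : m * m * m <= m ^ 4 by rewrite !expnS expn0; nia.
by have : 0 < m ^ 4; [rewrite expn_gt0 m_gt0|lia].
Qed.

Lemma exp2_lower_bound (f : nat -> nat) :
  (forall m, 2 ^ m <= f m) -> exp2_over_poly_lower_bound f.
Proof.
(* No polynomial factor is lost, so the constant polynomial 1 serves. *)
move=> lef; exists 1%R, 0 => m _; rewrite hornerC GRing.divr1 Num.Theory.ltr01.
by rewrite -GRing.natrX Num.Theory.ler_nat.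
Qed.

Theorem theorem11 (op : extremal_op) :
  exists (d : Order.disp_t) (U : nat -> finOrderType d)
         (F : forall m : nat, {set {set U m}}),
    [/\ bigO (fun m => #|U m|) (fun m => m ^ 2),
        bigO (fun m => Z (F m)) (fun m => m ^ 4)
      & exp2_over_poly_lower_bound (fun m => Z (apply_op op (F m)))].
Proof.
have cardU : bigO (fun m => #|'I_(m + m).+1|) (fun m => m ^ 2).
  by exists 3, 1 => m m_gt0; rewrite card_ord expnS expn1; nia.
exists _, (fun m => 'I_(m + m).+1 : finOrderType _).
case: op.
  exists (fun m => compl_family (hard_family m)); split=> //.
    exact: cubic_bigO_m4 Z_compl_hard_family.
  exact: exp2_lower_bound Z_maximal_compl_hard_family.
exists hard_family; split=> //; first exact: cubic_bigO_m4 Z_hard_family.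
exact: exp2_lower_bound Z_minimal_hard_family.
Qed.
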